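(* Let $n\ge 1$. Identifying a $1$-tuple $(A^{(1)})$ with the matrix $A^{(1)}$, the set $ASM^{-}_{n,1}$ is the set of $n\times n$ alternating sign matrices.
   Context: An alternating sign matrix is a square matrix with entries in $\{0,1,-1\}$ such that each row and each column sums to $1$ and the nonzero entries alternate in sign along each row and each column. For $n,k\ge1$, $ASM^{-}_{n,k}$ (chained linear alternating sign matrices) is the set of $k$-tuples $(A^{(1)},\dots,A^{(k)})$ of $n\times n$ matrices with entries in $\{-1,0,1\}$ satisfying: (1) $\sum_{j=1}^m A^{(\ell)}_{i,j}\in\{0,1\}$ for all $1\le i\le n$, $1\le m\le n$, $1\le\ell\le k$; (2) $\sum_{j=1}^n A^{(\ell-1)}_{i,j}+\sum_{j=1}^m A^{(\ell)}_{n+1-j,i}\in\{0,1\}$ for all $1\le i\le n$, $1\le m\le n$, $1\le\ell\le k$, where $A^{(0)}$ is the zero matrix; (3) the sum of all entries $\sum_{i,j,\ell}A^{(\ell)}_{i,j}$ is maximum among all such $k$-tuples satisfying (1) and (2). *)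

(* Defs.v *)
From mathcomp Require Import all_boot all_order all_algebra.
Set Implicit Arguments.
Unset Strict Implicit.
Unset Printing Implicit Defensive.
Import Order.TTheory GRing.Theory Num.Theory.
Local Open Scope ring_scope.

Definition sign_entries (n : nat) (A : 'M[int]_n) : Prop :=
  forall i j : 'I_n, A i j \in [:: -1; 0; 1].

(* Consecutive nonzero terms of s have opposite signs. *)
Definition alternates_in_sign (s : seq int) : bool :=
  sorted (fun x y => Num.sg y == - Num.sg x) [seq x <- s | x != 0].

Definition is_asm (n : nat) (A : 'M[int]_n) : Prop :=
  [/\ sign_entries A,
      (forall i : 'I_n, \sum_(j < n) A i j = 1),
      (forall j : 'I_n, \sum_(i < n) A i j = 1),
      (forall i : 'I_n, alternates_in_sign [seq A i j | j <- enum 'I_n]) &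
      (forall j : 'I_n, alternates_in_sign [seq A i j | i <- enum 'I_n])].

(* layer A l is A^(l): the matrices of the tuple are numbered from 1, and
   layer A 0 is the zero matrix. *)
Definition layer (n k : nat) (A : k.-tuple 'M[int]_n) (l : nat) : 'M[int]_n :=
  nth 0 (0 :: A) l.

Definition row_condition (n k : nat) (A : k.-tuple 'M[int]_n) : Prop :=
  forall (i : 'I_n) (m l : nat), (1 <= m <= n)%N -> (1 <= l <= k)%N ->
    \sum_(j < n | (j < m)%N) layer A l i j \in [:: 0; 1].

(* Matrix indices start at 0, so the row written n + 1 - j with 1 <= j <= m is
   rev_ord j with 0 <= j < m. *)
Definition chain_condition (n k : nat) (A : k.-tuple 'M[int]_n) : Prop :=
  forall (i : 'I_n) (m l : nat), (1 <= m <= n)%N -> (1 <= l <= k)%N ->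
    \sum_(j < n) layer A l.-1 i j
      + \sum_(j < n | (j < m)%N) layer A l (rev_ord j) i \in [:: 0; 1].

Definition pre_chained_linear_asm (n k : nat) (A : k.-tuple 'M[int]_n) : Prop :=
  [/\ (forall l : 'I_k, sign_entries (tnth A l)),
      row_condition A & chain_condition A].

Definition entry_sum (n k : nat) (A : k.-tuple 'M[int]_n) : int :=
  \sum_(l < k) \sum_(i < n) \sum_(j < n) tnth A l i j.

Definition chained_linear_asm (n k : nat) (A : k.-tuple 'M[int]_n) : Prop :=
  pre_chained_linear_asm A /\
  forall B : k.-tuple 'M[int]_n,
    pre_chained_linear_asm B -> entry_sum B <= entry_sum A.

(* Main.v *)
Require Import Defs.
From mathcomp Require Import all_boot all_order all_algebra.

(** The idea is a dictionary between partial sums and alternation of signs.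
    Read a sequence over -1, 0, 1 from left to right and keep its running sum.
    If the running sum is to stay in {0, 1}, then from 0 the only possible
    nonzero step is 1 and from 1 the only one is -1: the running sums stay in
    {0, 1} exactly when the nonzero entries alternate and the first of them is 1
    ([partial_sums01_path]).  When the total is 1, an alternating sequence cannot
    have -1 as its first nonzero entry, because the running sums from there on
    would be at most 0;
    so for total 1 the two conditions agree ([alternates_partial_sums01]).

    For k = 1, condition (1) bounds the partial sums of the rows and condition
    (2), where the zero matrix contributes nothing, those of the columns read
    from bottom to top.  Alternation and the total are invariant under reversal,
    so the direction of reading is harmless once all columns have total 1.

    It remains to see that maximality says that all row and column sums are 1.
    Under (1) and (2) each row and column sum is at most 1, so the sum of all
    entries is at most n, and the identity matrix reaches n.  Hence a maximal
    matrix has entry sum n, which forces every row sum and every column sum to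
    be 1 ([sum_ge_card_eq1]); conversely row sums 1 give the entry sum n. *)

Set Implicit Arguments.
Unset Strict Implicit.
Unset Printing Implicit Defensive.
Import Order.TTheory GRing.Theory Num.Theory.
Local Open Scope ring_scope.

Definition partial_sums01 (s : seq int) : Prop :=
  forall m : nat, \sum_(x <- take m s) x \in [:: 0; 1].

Definition opposite_sign (x y : int) : bool := Num.sg y == - Num.sg x.

Lemma running_sum01_cons (b x : int) (s : seq int) : b \in [:: 0; 1] ->
  (forall m, b + \sum_(y <- take m (x :: s)) y \in [:: 0; 1]) <->
  (forall m, b + x + \sum_(y <- take m s) y \in [:: 0; 1]).
Proof.
move=> b01; split=> [sums m | sums [|m]].
- by have := sums m.+1; rewrite /= big_cons addrA.
- by rewrite take0 big_nil addr0.
- by rewrite /= big_cons addrA.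
Qed.

(** The running sum b, just before s, remembers the sign of the last nonzero
    entry read: 1 if b = 1 and -1 if b = 0.  Each entry of s is then allowed by
    one side exactly when it is allowed by the other, which is why the induction
    has to carry b. *)
Lemma running_sum01_path (b : bool) (s : seq int) :
  all [in [:: -1; 0; 1]] s ->
  (forall m, b%:R + \sum_(x <- take m s) x \in [:: 0; 1]) <->
  path opposite_sign (if b then 1 else -1) [seq x <- s | x != 0].
Proof.
elim: s b => [|x s IHs] b; first by case: b => _; split=> // _ m; rewrite big_nil.
case/andP=> x_sign /[dup] /(IHs false) IHs0 /(IHs true) IHs1.
have b01 : b%:R \in [:: 0; 1 : int] by case: b.
apply: iff_trans (running_sum01_cons x s b01) _.
have head_sum : (forall m, b%:R + x + \sum_(y <- take m s) y \in [:: 0; 1]) ->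
    b%:R + x \in [:: 0; 1].
  by move/(_ 0); rewrite take0 big_nil addr0.
rewrite !inE in x_sign.
(* In the two cases where the signs clash, b + x is 2 or -1. *)
case/or3P: x_sign head_sum => /eqP-> head_sum.
all: by case: b b01 head_sum => //= _ head_sum; split=> // /head_sum.
Qed.

(** The starting sum 0 behaves as if -1 had just been read, so that the first
    nonzero entry has to be 1. *)
Lemma partial_sums01_path (s : seq int) : all [in [:: -1; 0; 1]] s ->
  partial_sums01 s <-> path opposite_sign (-1) [seq x <- s | x != 0].
Proof.
move=> s_sign; apply: iff_trans (running_sum01_path false s_sign).
by split=> sums m; have := sums m; rewrite add0r.
Qed.

(** The two conditions differ only for alternating sequences whose first nonzero
    entry is -1.  The entries after that -1 have a sum in {0, 1}, so the total is
    at most 0, against the hypothesis. *)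
Lemma alternates_partial_sums01 (s : seq int) : all [in [:: -1; 0; 1]] s ->
  \sum_(x <- s) x = 1 -> alternates_in_sign s <-> partial_sums01 s.
Proof.
move=> s_sign s_sum; split=> [alt|/(partial_sums01_path s_sign)/path_sorted//].
apply/(partial_sums01_path s_sign); move: alt; rewrite /alternates_in_sign.
elim: s s_sign s_sum => [|x s IHs] //= /andP[x_sign s_sign].
rewrite big_cons; move: x_sign; rewrite !inE => /or3P[] /eqP-> //= sum1.
  (* The first nonzero entry is -1: the remaining entries would sum to 2. *)
  move/(partial_sums01_path s_sign)/(_ (size s)).
  by rewrite take_size !inE => /orP[] /eqP sumE; rewrite sumE in sum1.
by apply: IHs; rewrite // -sum1 add0r.
Qed.

Lemma alternates_in_sign_rev (s : seq int) :
  alternates_in_sign (rev s) = alternates_in_sign s.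
Proof.
rewrite /alternates_in_sign filter_rev rev_sorted.
by apply: eq_sorted => x y; rewrite eq_sym eqr_oppLR.
Qed.

Lemma take_enum_ord (n m : nat) :
  take m (enum 'I_n) = [seq j : 'I_n <- enum 'I_n | (j < m)%N].
Proof.
apply: (inj_map val_inj); rewrite map_take -(filter_map val (fun j => j < m)%N).
rewrite val_enum_ord take_iota -(@filter_iota_ltn 0 n) ?geq_minr //.
apply: eq_in_filter => j; rewrite mem_iota => /andP[_ lt_jn].
by rewrite add0n leq_min [(j < n)%N]lt_jn andbT.
Qed.

Lemma map_rev_ord_enum (n : nat) :
  map (@rev_ord n) (enum 'I_n) = rev (enum 'I_n).
Proof.
apply: (inj_map val_inj); apply: (@eq_from_nth _ 0%N) => [|j].
  by rewrite !(size_map, size_rev).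
rewrite 2!size_map size_enum_ord => lt_jn; rewrite map_rev val_enum_ord.
rewrite nth_rev ?size_iota // nth_iota ?add0n; last first.
  by rewrite ltn_subrL (leq_ltn_trans _ lt_jn).
by rewrite -map_comp (nth_map (Ordinal lt_jn)) ?size_enum_ord //= nth_enum_ord.
Qed.

Lemma sum_take_enum_ord (n m : nat) (F : 'I_n -> int) :
  \sum_(x <- take m [seq F j | j <- enum 'I_n]) x = \sum_(j < n | (j < m)%N) F j.
Proof. by rewrite -map_take take_enum_ord big_map big_filter big_enum_cond. Qed.

Lemma sum_enum_ord (n : nat) (F : 'I_n -> int) :
  \sum_(x <- [seq F j | j <- enum 'I_n]) x = \sum_(j < n) F j.
Proof. by rewrite big_map big_enum. Qed.

(** The bounds 1 <= m <= n lose nothing: for m = 0 or n = 0 the sum is empty, and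
    for m > n > 0 it is the full sum, already obtained for m = n. *)
Lemma bounded_partial_sums01 (n : nat) (F : 'I_n -> int) :
  (forall m : nat, (1 <= m <= n)%N ->
    \sum_(j < n | (j < m)%N) F j \in [:: 0; 1]) <->
  partial_sums01 [seq F j | j <- enum 'I_n].
Proof.
split=> sums m; last by rewrite -sum_take_enum_ord.
have [->|m_gt0] := posnP m; first by rewrite take0 big_nil.
have [le_mn|/ltnW le_nm] := leqP m n.
  by rewrite sum_take_enum_ord sums ?m_gt0.
rewrite take_oversize; last by rewrite size_map size_enum_ord.
have [n0|n_gt0] := posnP n.
  rewrite sum_enum_ord big1 // => j _.
  by suff: (j < 0)%N by []; rewrite -n0.
rewrite sum_enum_ord; have := sums n; rewrite n_gt0 leqnn => /(_ isT).
by rewrite (eq_bigl xpredT) // => j; apply: ltn_ord.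
Qed.

(** The gaps 1 - F i are nonnegative with a sum at most 0, so they all vanish. *)
Lemma sum_ge_card_eq1 (n : nat) (F : 'I_n -> int) :
  (forall i, F i <= 1) -> n%:R <= \sum_(i < n) F i -> forall i, F i = 1.
Proof.
move=> F_le1 sum_ge i.
have gap_ge0 (j : 'I_n) : true -> 0 <= 1 - F j by rewrite subr_ge0.
have /(psumr_eq0P gap_ge0)/(_ i isT)/eqP : \sum_(j < n) (1 - F j) = 0.
  apply/le_anti; rewrite sumr_ge0 // andbT.
  by rewrite sumrB sumr_const card_ord subr_le0.
by rewrite subr_eq0 => /eqP.
Qed.

Lemma sum_indicator01 (n : nat) (P : pred 'I_n) (F : pred 'I_n) (i : 'I_n) :
  (forall j, F j -> j = i) -> \sum_(j < n | P j) (F j)%:R \in [:: 0; 1 : int].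
Proof.
move=> F_i; rewrite big_mkcond (bigD1 i) //= big1 ?addr0 => [|j ne_ji].
  by case: ifP; case: (F i).
by case: ifP => // _; case: (boolP (F j)) => // /F_i /eqP; rewrite (negPf ne_ji).
Qed.

(** With a single matrix the previous layer is the zero matrix, so the chain
    condition constrains each column separately, read from bottom to top. *)
Lemma pre_chained1P (n : nat) (A : 'M[int]_n) :
  pre_chained_linear_asm [tuple A] <->
  [/\ sign_entries A,
      (forall i, partial_sums01 [seq A i j | j <- enum 'I_n]) &
      (forall j, partial_sums01 [seq A (rev_ord i) j | i <- enum 'I_n])].
Proof.
split=> [[sgn rows cols]|[sgn rows cols]]; split.
- exact: (sgn ord0).
- by move=> i; apply/bounded_partial_sums01 => m m_le; apply: (rows i m 1%N).
- move=> j; apply/bounded_partial_sums01 => m m_le.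
  by have := cols j m 1%N m_le isT; rewrite big1 ?add0r // => l _; rewrite mxE.
- by move=> l; rewrite ord1.
- move=> i m [|[|l]] // m_le _.
  by have /bounded_partial_sums01 := rows i; apply.
- move=> i m [|[|l]] // m_le _.
  rewrite [X in X + _]big1 ?add0r => [|j _]; last by rewrite mxE.
  by have /bounded_partial_sums01 := cols i; apply.
Qed.

(** The identity is the witness that makes the bound n on the entry sum sharp. *)
Lemma pre_chained1_scalar1 (n : nat) :
  pre_chained_linear_asm [tuple 1%:M : 'M[int]_n].
Proof.
apply/pre_chained1P; split=> [i j|i|i].
- by rewrite mxE; case: eqP.
- apply/bounded_partial_sums01 => m _; rewrite (eq_bigr _ (fun j _ => mxE _ _ i j)).
  by apply: (@sum_indicator01 _ _ _ i) => j /eqP.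
- apply/bounded_partial_sums01 => m _.
  rewrite (eq_bigr _ (fun j _ => mxE _ _ (rev_ord j) i)).
  by apply: (@sum_indicator01 _ _ _ (rev_ord i)) => j /eqP<-; rewrite rev_ordK.
Qed.

Lemma entry_sum1 (n : nat) (A : 'M[int]_n) :
  entry_sum [tuple A] = \sum_(i < n) \sum_(j < n) A i j.
Proof. by rewrite /entry_sum big_ord1. Qed.

Lemma entry_sum_scalar1 (n : nat) : entry_sum [tuple 1%:M : 'M[int]_n] = n%:R.
Proof.
rewrite entry_sum1 -[RHS]mxtrace1 exchange_big; apply: eq_bigr => j _.
rewrite (bigD1 j) //= big1 ?addr0 // => i /negPf ne_ij.
by rewrite mxE ne_ij.
Qed.

Lemma partial_sums01_sum_le1 (n : nat) (F : 'I_n -> int) :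
  partial_sums01 [seq F j | j <- enum 'I_n] -> \sum_(j < n) F j <= 1.
Proof.
move/(_ n); rewrite take_oversize ?sum_enum_ord; last by rewrite size_map size_enum_ord.
by rewrite !inE => /orP[] /eqP->.
Qed.

Lemma alternates_rev_enum (n : nat) (F : 'I_n -> int) :
  alternates_in_sign [seq F (rev_ord i) | i <- enum 'I_n] =
  alternates_in_sign [seq F i | i <- enum 'I_n].
Proof.
rewrite (map_comp F (@rev_ord n)) map_rev_ord_enum map_rev.
exact: alternates_in_sign_rev.
Qed.

Lemma alternates_enum_partial_sums01 (n : nat) (F : 'I_n -> int) :
  (forall i, F i \in [:: -1; 0; 1]) -> \sum_(i < n) F i = 1 ->
  alternates_in_sign [seq F i | i <- enum 'I_n] <->
  partial_sums01 [seq F i | i <- enum 'I_n].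
Proof.
move=> F_sign F_sum; apply: alternates_partial_sums01; last by rewrite sum_enum_ord.
by apply/allP=> _ /mapP[i _ ->]; apply: F_sign.
Qed.

Lemma sum_rev_ord (n : nat) (F : 'I_n -> int) :
  \sum_(i < n) F (rev_ord i) = \sum_(i < n) F i.
Proof. by rewrite [RHS](reindex_inj rev_ord_inj). Qed.

(** Under unit row and column sums the dictionary applies to every line; a
    column is reversed once, which does not affect alternation. *)
Lemma pre_chained1_asm (n : nat) (A : 'M[int]_n) :
  (forall i, \sum_(j < n) A i j = 1) -> (forall j, \sum_(i < n) A i j = 1) ->
  pre_chained_linear_asm [tuple A] <-> is_asm A.
Proof.
move=> row1 col1; apply: iff_trans (pre_chained1P A) _.
have rowP i : sign_entries A -> _ :=
  fun sgn => alternates_enum_partial_sums01 (sgn i) (row1 i).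
have colP j : sign_entries A -> _ :=
  fun sgn => alternates_enum_partial_sums01 (fun i => sgn (rev_ord i) j)
    (etrans (sum_rev_ord (A^~ j)) (col1 j)).
split=> [[sgn rows cols]|[sgn _ _ rows cols]]; split=> // k.
- exact/(rowP k sgn).
- by rewrite -alternates_rev_enum; apply/(colP k sgn).
- exact/(rowP k sgn).
- by apply/(colP k sgn); rewrite (alternates_rev_enum (A^~ k)).
Qed.

Theorem proposition4p6 (n : nat) (hn : (1 <= n)%N) (A : 'M[int]_n) :
  chained_linear_asm [tuple A] <-> is_asm A.
Proof.
split=> [[preA maxA] | asmA].
  have [_ rows cols] := (pre_chained1P A).1 preA.
  (* Comparing A with the identity gives the entry sum at least n. *)
  have sum_ge := maxA _ (pre_chained1_scalar1 n).
  rewrite entry_sum_scalar1 entry_sum1 in sum_ge.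
  apply/pre_chained1_asm => //; apply: sum_ge_card_eq1.
  - by move=> i; apply: partial_sums01_sum_le1.
  - exact: sum_ge.
  - by move=> j; rewrite -sum_rev_ord; apply: partial_sums01_sum_le1.
  - by rewrite exchange_big.
have [_ row1 col1 _ _] := asmA.
split=> [|B]; first exact/pre_chained1_asm.
case: (tupleP B) => {}B t; rewrite (tuple0 t).
case/pre_chained1P=> _ rowsB _; rewrite !entry_sum1.
by apply: ler_sum => i _; rewrite row1; apply: partial_sums01_sum_le1.
Qed.
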